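(* Under the conditions $$b(t)=\frac{2\eta}{t(t-1)\{t^2+(2\eta-1)t+\eta(\eta-1)\}},\qquad x=y-t,$$ for the $D_4^{(1)}$ system (defined in the context) make the change of parameters and variables $$\alpha_0=A_1,\quad \alpha_1=A_0,\quad \alpha_2=A_2,\quad \alpha_3=A_3,\quad \alpha_4=A_4,\quad X:=y,\quad Y:=z$$ from $\alpha_0,\alpha_1,\ldots,\alpha_4,x,y,z$ to $A_i,X,Y$. Then the $D_4^{(1)}$ system can also be written in the new variables $X,Y$ and parameters $A_i$ as a Hamiltonian system. This new system tends to $$\frac{dX}{dt}=\frac{\partial H_{VI}}{\partial Y},\qquad \frac{dY}{dt}=-\frac{\partial H_{VI}}{\partial X}$$ with the polynomial Hamiltonian $$H_{VI}(X,Y,t;A_1,A_0,A_2,A_3,A_4)=\frac{1}{t(t-1)}\Big[Y^2(X-t)(X-1)X-\{(A_1-1)(X-1)X+A_3(X-t)X+A_4(X-t)(X-1)\}Y+A_2(A_0+A_2)X\Big]$$ as $\eta\rightarrow\infty$.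
   Context: The $D_4^{(1)}$ system. Let $\eta\in\mathbb{C}\setminus\{0\}$, let $b(t)\in\mathbb{C}(t)$, and let $\alpha_0,\dots,\alpha_4$ be complex parameters satisfying $\alpha_0+\alpha_1+2\alpha_2+\alpha_3+\alpha_4=1$. The $D_4^{(1)}$ system for unknown complex variables $x,y,z$ (functions of $t$) is $$\frac{2\eta}{b(t)}\frac{dx}{dt}=P,\qquad -\frac{2\eta}{b(t)}\frac{dy}{dt}=Q,\qquad \frac{2\eta}{b(t)}\frac{dz}{dt}=R,$$ where $P=-2x(y-1)yz(x-\eta)(2x-2y+1-\eta)-2(2\alpha_0+2\alpha_1+4\alpha_2+\alpha_3+\alpha_4)x^3y-2(\alpha_0+\alpha_1)xy^3+(5\alpha_0+5\alpha_1+6\alpha_2+\alpha_3+\alpha_4)x^2y^2-\{5\alpha_0+5\alpha_1+6\alpha_2+2\alpha_3-3(2\alpha_0+2\alpha_1+4\alpha_2+\alpha_3+\alpha_4)\eta\}x^2y+\{3(\alpha_0+\alpha_1)-(4\alpha_0+6\alpha_1+6\alpha_2+\alpha_3+\alpha_4)\eta\}xy^2+x^4+2(\alpha_0+\alpha_1+2\alpha_2+\alpha_3-\eta)x^3+2\alpha_1\eta y^3+\{(\alpha_0+\alpha_1+2\alpha_2+\alpha_3)(\eta^2-3\eta+1)+\alpha_4\eta^2\}x^2+\alpha_1(\eta-3)\eta y^2+\{-(\alpha_0+\alpha_1)+2(2\alpha_0+3\alpha_1+3\alpha_2+\alpha_3)\eta-(2\alpha_0+2\alpha_1+4\alpha_2+\alpha_3+\alpha_4)\eta^2\}xy+(\alpha_0+\alpha_1+2\alpha_2+\alpha_3)(\eta-1)\eta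 x-\alpha_1(\eta-1)\eta y$, $Q=2x(y-1)yz(x-\eta)(2x-2y+1-\eta)-2(\alpha_3+\alpha_4)x^3y-2(\alpha_0+\alpha_1+4\alpha_2+2\alpha_3+2\alpha_4)xy^3+(\alpha_0+\alpha_1+6\alpha_2+5\alpha_3+5\alpha_4)x^2y^2+\{-(\alpha_0+\alpha_1+6\alpha_2+4\alpha_3+6\alpha_4)+3(\alpha_3+\alpha_4)\eta\}x^2y+\{3(\alpha_0+\alpha_1+4\alpha_2+2\alpha_3+2\alpha_4)-(2\alpha_0+6\alpha_2+5\alpha_3+5\alpha_4)\eta\}xy^2+y^4+2\alpha_4x^3+2\{(\alpha_0+2\alpha_2+\alpha_3+\alpha_4)\eta-1\}y^3-\alpha_4(3\eta-1)x^2+\{1-3(\alpha_0+2\alpha_2+\alpha_3+\alpha_4)\eta+(\alpha_0+2\alpha_2+\alpha_3+\alpha_4)\eta^2\}y^2+\{-(\alpha_0+\alpha_1+4\alpha_2+2\alpha_3+2\alpha_4)+2(\alpha_0+3\alpha_2+2\alpha_3+3\alpha_4)\eta-(\alpha_3+\alpha_4)\eta^2\}xy+\alpha_4(\eta-1)\eta x-(\alpha_0+2\alpha_2+\alpha_3+\alpha_4)(\eta-1)\eta y$, $R=(2x-2y+1-\eta)\{2x^2y+2xy^2-x^2-\eta y^2-2(\eta+1)xy+\eta(x+y)\}z^2+z\big[-2(\alpha_3+\alpha_4)x^3+2(\alpha_0+\alpha_1)y^3+2(\alpha_0+\alpha_1+6\alpha_2+2\alpha_3+2\alpha_4)x^2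y-2(2\alpha_0+2\alpha_1+6\alpha_2+\alpha_3+\alpha_4)xy^2+\{-(\alpha_0+\alpha_1+6\alpha_2+4\alpha_3)+3(\alpha_3+\alpha_4)\eta\}x^2+\{-3(\alpha_0+\alpha_1)+(4\alpha_0+6\alpha_2+\alpha_3+\alpha_4)\eta\}y^2-4\{-(\alpha_0+\alpha_1+3\alpha_2+\alpha_3)+(\alpha_0+3\alpha_2+\alpha_3+\alpha_4)\eta\}xy+\{-(\alpha_0+\alpha_1+4\alpha_2+2\alpha_3)+2(\alpha_0+3\alpha_2+2\alpha_3)\eta-(\alpha_3+\alpha_4)\eta^2\}x+\{\alpha_0+\alpha_1-2(2\alpha_0+3\alpha_2+\alpha_3)\eta+(2\alpha_0+4\alpha_2+\alpha_3+\alpha_4)\eta^2\}y-(\alpha_0+2\alpha_2+\alpha_3)(\eta-1)\eta\big]+\alpha_2\big[(\alpha_0+\alpha_1+2\alpha_2-\alpha_3-\alpha_4)x^2+(\alpha_0+\alpha_1-2\alpha_2-\alpha_3-\alpha_4)y^2-2(\alpha_0+\alpha_1-\alpha_3-\alpha_4)xy+\{\alpha_0+\alpha_1-2\alpha_3-(2\alpha_0+2\alpha_2-\alpha_3-\alpha_4)\eta\}x+\{-\alpha_0-\alpha_1+2\alpha_2+2\alpha_3+(2\alpha_0-\alpha_3-\alpha_4)\eta\}y+(\eta-1)(\alpha_2+\alpha_3+(\alpha_0+\alpha_2)\eta)\big]$.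
   Formalization: The sign of b is reversed (b = −2η/(t(t−1){…})), since with the printed sign x = y−t forces −1 = 1; and A_0, A_1 are exchanged in H_VI (terms (A_0−1)(X−1)X and A_2(A_1+A_2)X), since the printed limit fails unless α_0 = α_1. *)

(* Defs.v *)
From HB Require Import structures.
From mathcomp Require Import all_boot all_order all_algebra fraction complex.
From mathcomp Require Import all_classical all_reals all_analysis.

Set Implicit Arguments.
Unset Strict Implicit.
Unset Printing Implicit Defensive.

Import Order.TTheory GRing.Theory Num.Theory.
Import numFieldNormedType.Exports.

Local Open Scope classical_set_scope.
Local Open Scope ring_scope.

(* The definitions are generic in a ring or field K, and are meant to be used
   with K := R[i], R : realType.  The regular algebra K^o carries the normed
   topology of the modulus, so that [derivable f t 1] and [derive1 f t] for
   f : K^o -> K^o are then complex differentiability and the complex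
   derivative. *)

Definition D4_P (K : comNzRingType) (a0 a1 a2 a3 a4 eta x y z : K) : K :=
  - 2 * x * (y - 1) * y * z * (x - eta) * (2 * x - 2 * y + 1 - eta)
  - 2 * (2 * a0 + 2 * a1 + 4 * a2 + a3 + a4) * x ^+ 3 * y
  - 2 * (a0 + a1) * x * y ^+ 3
  + (5 * a0 + 5 * a1 + 6 * a2 + a3 + a4) * x ^+ 2 * y ^+ 2
  - (5 * a0 + 5 * a1 + 6 * a2 + 2 * a3
     - 3 * (2 * a0 + 2 * a1 + 4 * a2 + a3 + a4) * eta) * x ^+ 2 * y
  + (3 * (a0 + a1) - (4 * a0 + 6 * a1 + 6 * a2 + a3 + a4) * eta) * x * y ^+ 2
  + x ^+ 4
  + 2 * (a0 + a1 + 2 * a2 + a3 - eta) * x ^+ 3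
  + 2 * a1 * eta * y ^+ 3
  + ((a0 + a1 + 2 * a2 + a3) * (eta ^+ 2 - 3 * eta + 1)
     + a4 * eta ^+ 2) * x ^+ 2
  + a1 * (eta - 3) * eta * y ^+ 2
  + (- (a0 + a1) + 2 * (2 * a0 + 3 * a1 + 3 * a2 + a3) * eta
     - (2 * a0 + 2 * a1 + 4 * a2 + a3 + a4) * eta ^+ 2) * x * y
  + (a0 + a1 + 2 * a2 + a3) * (eta - 1) * eta * x
  - a1 * (eta - 1) * eta * y.

Definition D4_Q (K : comNzRingType) (a0 a1 a2 a3 a4 eta x y z : K) : K :=
  2 * x * (y - 1) * y * z * (x - eta) * (2 * x - 2 * y + 1 - eta)
  - 2 * (a3 + a4) * x ^+ 3 * y
  - 2 * (a0 + a1 + 4 * a2 + 2 * a3 + 2 * a4) * x * y ^+ 3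
  + (a0 + a1 + 6 * a2 + 5 * a3 + 5 * a4) * x ^+ 2 * y ^+ 2
  + (- (a0 + a1 + 6 * a2 + 4 * a3 + 6 * a4)
     + 3 * (a3 + a4) * eta) * x ^+ 2 * y
  + (3 * (a0 + a1 + 4 * a2 + 2 * a3 + 2 * a4)
     - (2 * a0 + 6 * a2 + 5 * a3 + 5 * a4) * eta) * x * y ^+ 2
  + y ^+ 4
  + 2 * a4 * x ^+ 3
  + 2 * ((a0 + 2 * a2 + a3 + a4) * eta - 1) * y ^+ 3
  - a4 * (3 * eta - 1) * x ^+ 2
  + (1 - 3 * (a0 + 2 * a2 + a3 + a4) * eta
     + (a0 + 2 * a2 + a3 + a4) * eta ^+ 2) * y ^+ 2
  + (- (a0 + a1 + 4 * a2 + 2 * a3 + 2 * a4)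
     + 2 * (a0 + 3 * a2 + 2 * a3 + 3 * a4) * eta
     - (a3 + a4) * eta ^+ 2) * x * y
  + a4 * (eta - 1) * eta * x
  - (a0 + 2 * a2 + a3 + a4) * (eta - 1) * eta * y.

Definition D4_R (K : comNzRingType) (a0 a1 a2 a3 a4 eta x y z : K) : K :=
  (2 * x - 2 * y + 1 - eta)
  * (2 * x ^+ 2 * y + 2 * x * y ^+ 2 - x ^+ 2 - eta * y ^+ 2
     - 2 * (eta + 1) * x * y + eta * (x + y)) * z ^+ 2
  + z * (
      - 2 * (a3 + a4) * x ^+ 3
      + 2 * (a0 + a1) * y ^+ 3
      + 2 * (a0 + a1 + 6 * a2 + 2 * a3 + 2 * a4) * x ^+ 2 * y
      - 2 * (2 * a0 + 2 * a1 + 6 * a2 + a3 + a4) * x * y ^+ 2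
      + (- (a0 + a1 + 6 * a2 + 4 * a3) + 3 * (a3 + a4) * eta) * x ^+ 2
      + (- 3 * (a0 + a1) + (4 * a0 + 6 * a2 + a3 + a4) * eta) * y ^+ 2
      - 4 * (- (a0 + a1 + 3 * a2 + a3)
             + (a0 + 3 * a2 + a3 + a4) * eta) * x * y
      + (- (a0 + a1 + 4 * a2 + 2 * a3) + 2 * (a0 + 3 * a2 + 2 * a3) * eta
         - (a3 + a4) * eta ^+ 2) * x
      + (a0 + a1 - 2 * (2 * a0 + 3 * a2 + a3) * eta
         + (2 * a0 + 4 * a2 + a3 + a4) * eta ^+ 2) * y
      - (a0 + 2 * a2 + a3) * (eta - 1) * eta)
  + a2 * (
      (a0 + a1 + 2 * a2 - a3 - a4) * x ^+ 2
      + (a0 + a1 - 2 * a2 - a3 - a4) * y ^+ 2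
      - 2 * (a0 + a1 - a3 - a4) * x * y
      + (a0 + a1 - 2 * a3 - (2 * a0 + 2 * a2 - a3 - a4) * eta) * x
      + (- a0 - a1 + 2 * a2 + 2 * a3 + (2 * a0 - a3 - a4) * eta) * y
      + (eta - 1) * (a2 + a3 + (a0 + a2) * eta)).

(* An element of C(t) is given by a ratio of polynomials; the value is only
   meaningful where the denominator does not vanish. *)
Definition ratio_eval (K : fieldType) (b : {ratio {poly K}}) (t : K) : K :=
  (b.1).[t] / (b.2).[t].

Definition D4_system (K : numFieldType) (eta : K) (b : {ratio {poly K}})
    (a0 a1 a2 a3 a4 : K) (x y z : K^o -> K^o) (t : K) : Prop :=
  [/\ derivable x t 1, derivable y t 1 & derivable z t 1] /\
  [/\ 2 * eta / ratio_eval b t * derive1 x t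
        = D4_P a0 a1 a2 a3 a4 eta (x t) (y t) (z t),
      - (2 * eta / ratio_eval b t) * derive1 y t
        = D4_Q a0 a1 a2 a3 a4 eta (x t) (y t) (z t)
    & 2 * eta / ratio_eval b t * derive1 z t
        = D4_R a0 a1 a2 a3 a4 eta (x t) (y t) (z t)].

Definition VI_den (K : fieldType) (eta : K) : {poly K} :=
  'X * ('X - 1) *
  ('X^2 + (2 * eta - 1) *: 'X + (eta * (eta - 1))%:P).

(* The sign is forced.  If a0 + a1 + 2 a2 + a3 + a4 = 1 and x = y - t, then
   D4_P + D4_Q is identically the value at t of VI_den eta, while the first
   two equations of the system give
     (2 eta / b) * (x - y)' = D4_P + D4_Q   with   (x - y)' = - 1;
   with b = + 2 eta / VI_den no solution would satisfy x = y - t. *)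
Definition VI_b (K : fieldType) (eta : K) : {ratio {poly K}} :=
  Ratio (- (2 * eta))%:P (VI_den eta).

(* H_VI(X,Y,t;c0,c1,c2,c3,c4), the five parameters being taken by position.
   The limit system determines the first two: for x = y - t the eta ^+ 2
   coefficient of D4_Q contains (a0 + 2 a2 + a3 + a4) y (y - 1)
   = - (a1 - 1) y (y - 1), and that of D4_R contains a2 (a0 + a2), so that
   c0 = a1 and c1 = a0. *)
Definition H_VI (K : fieldType) (c0 c1 c2 c3 c4 : K) (X Y t : K) : K :=
  1 / (t * (t - 1)) *
  (Y ^+ 2 * (X - t) * (X - 1) * X
   - ((c0 - 1) * (X - 1) * X + c3 * (X - t) * X + c4 * (X - t) * (X - 1)) * Y
   + c2 * (c1 + c2) * X).

Section Hamiltonian.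
Variable K : numFieldType.
Implicit Type H : K^o -> K^o -> K^o -> K^o.

Definition partialX H (X Y t : K^o) : K^o := derive1 (fun X' => H X' Y t) X.
Definition partialY H (X Y t : K^o) : K^o := derive1 (fun Y' => H X Y' t) Y.

Definition has_partials H (X Y t : K^o) : Prop :=
  derivable (fun X' => H X' Y t) X 1 /\ derivable (fun Y' => H X Y' t) Y 1.

Definition hamiltonian_system H (X Y : K^o -> K^o) (t : K) : Prop :=
  [/\ derivable X t 1, derivable Y t 1,
      derive1 X t = partialY H (X t) (Y t) t
    & derive1 Y t = - partialX H (X t) (Y t) t].

End Hamiltonian.

(* Neighbourhoods of the point at infinity of the Riemann sphere. *)
Definition cinfty_nbhs (K : numFieldType) : set_system K :=
  fun P => exists M, M \is Num.real /\ forall u, M < `|u| -> P u.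
Arguments cinfty_nbhs K : clear implicits.

Global Instance cinfty_nbhs_filter (K : numFieldType) :
  ProperFilter (cinfty_nbhs K).
Proof.
apply: Build_ProperFilter_ex.
- move=> P [M [Mr MP]]; exists (`|M| + 1); apply: MP.
  rewrite ger0_norm ?addr_ge0//.
  by rewrite (le_lt_trans (real_ler_norm Mr))// ltrDl.
- split.
  + by exists 0; split.
  + move=> P Q [M [Mr MP]] [N [Nr NQ]]; exists (`|M| + `|N|).
    split; first by rewrite realD.
    move=> u Hu; split; [apply: MP|apply: NQ]; apply: le_lt_trans Hu.
      by rewrite (le_trans (real_ler_norm Mr))// lerDl.
    by rewrite (le_trans (real_ler_norm Nr))// lerDr.
  + by move=> P Q PQ [M [Mr MP]]; exists M; split => // u /MP /PQ.
Qed.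

(* Main.v *)
Require Import Defs.
From mathcomp Require Import all_boot all_order all_algebra fraction complex.
From mathcomp Require Import all_classical all_reals all_analysis.
From mathcomp Require Import ring.
Import Order.TTheory GRing.Theory Num.Theory.
Import numFieldNormedType.Exports.
Local Open Scope classical_set_scope.
Local Open Scope ring_scope.

(** Why it holds.  On the locus x = y - t, with X = y and Y = z, one has
    2 eta / b = - VI_den eta, so that the last two equations of the system
    become X' = D4_Q / VI_den and Y' = - D4_R / VI_den, both taken at
    (x, y, z) = (X - t, X, Y).  The first equation is then redundant: as the
    parameters sum to 1, D4_P + D4_Q is identically VI_den eta at t
    ([D4_PQ_sum]), which is exactly the condition x' = y' - 1.

    The remaining pair of equations is Hamiltonian because, again when the
    parameters sum to 1, the Y-derivative of D4_R (X - t, X, Y) equals the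
    X-derivative of D4_Q (X - t, X, Y).  A common primitive [D4_ham_num] is
    quadratic in Y, and [D4_ham] is its quotient by VI_den, which depends on
    neither X nor Y ([D4_ham_derivX], [D4_ham_derivY],
    [D4_system_hamiltonian]).

    For the limit, both D4_Q and D4_R are polynomials of degree 2 in eta, as
    is VI_den eta = t (t - 1) (t + eta) (t + eta - 1).  Such a quotient tends
    to the ratio of the coefficients of eta ^ 2
    ([cvg_quadratic_over_VI_den]), and the top coefficients of D4_Q and D4_R
    are t (t - 1) times the partial derivatives of the Hamiltonian of
    Painleve VI. *)

Lemma horner_VI_den (K : fieldType) (eta t : K) :
  (VI_den eta).[t] = t * (t - 1) * (t + eta) * (t + eta - 1).
Proof. by rewrite /VI_den !hornerE; ring. Qed.

Lemma two_eta_over_VI_b (K : numFieldType) (eta t : K) :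
  eta != 0 -> (VI_den eta).[t] != 0 ->
  2 * eta / ratio_eval (VI_b eta) t = - (VI_den eta).[t].
Proof.
move=> eta0 dent; rewrite /ratio_eval /VI_b.
rewrite !numden_Ratio; try by apply: contraNneq dent => ->; rewrite horner0.
rewrite hornerC invf_div mulrCA invrN !mulrN divff ?mulr1//.
by rewrite mulf_neq0 ?pnatr_eq0.
Qed.

Section LimitAtInfinity.
Context {K : numFieldType}.

Lemma cvg_inv_cinfty : (u^-1 : K^o) @[u --> cinfty_nbhs K] --> (0 : K^o).
Proof.
apply/cvgrPdist_lt => e e0; exists e^-1; split.
  by rewrite gtr0_real ?invr_gt0.
move=> u eu; rewrite sub0r normrN normfV.
have u0 : 0 < `|u| by apply: lt_trans eu; rewrite invr_gt0.
by rewrite -[ltRHS]invrK ltf_pV2 ?posrE ?invr_gt0.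
Qed.

(** In the variable v = 1 / u the quotient is a rational function that is
    regular at v = 0, because t (t - 1) is nonzero. *)
Lemma cvg_quadratic_over_VI_den (t q2 q1 q0 : K) : t != 0 -> t != 1 ->
  ((q2 * u ^+ 2 + q1 * u + q0) / (VI_den u).[t] : K^o)
    @[u --> cinfty_nbhs K] --> (q2 / (t * (t - 1)) : K^o).
Proof.
move=> t0 t1.
pose num (v : K^o) : K^o := q2 + q1 * v + q0 * v ^+ 2.
pose den (v : K^o) : K^o := t * (t - 1) * (1 + t * v) * (1 + (t - 1) * v).
pose g v := num v / den v.
have cg : {for 0, continuous g}.
  apply: continuousM; last apply: continuousV.
  - apply: differentiable_continuous; apply/derivable1_diffP; rewrite /num.
    exact: ex_derive.
  - by rewrite /den !mulr0 !addr0 !mulr1 mulf_neq0// subr_eq0.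
  - apply: differentiable_continuous; apply/derivable1_diffP; rewrite /den.
    exact: ex_derive.
have -> : q2 / (t * (t - 1)) = g 0.
  by rewrite /g /num /den !mulr0 expr0n /= mulr0 !addr0 !mulr1.
apply: cvg_trans (cvg_comp _ _ cvg_inv_cinfty cg); apply: near_eq_cvg.
exists 0; split; first exact: real0.
move=> u; rewrite normr_gt0 => u0 /=; rewrite /g /num /den horner_VI_den.
have -> : q2 + q1 * u^-1 + q0 * u^-1 ^+ 2
    = (q2 * u ^+ 2 + q1 * u + q0) * (u ^+ 2)^-1 by field.
have -> : t * (t - 1) * (1 + t * u^-1) * (1 + (t - 1) * u^-1)
    = t * (t - 1) * (t + u) * (t + u - 1) * (u ^+ 2)^-1 by field.
by rewrite -mulf_div divff ?mulr1// invr_neq0// expf_neq0.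
Qed.

End LimitAtInfinity.

Section D4Hamiltonian.
Context {K : numFieldType}.
Variables a0 a1 a2 a3 a4 : K.
Hypothesis sum_a : a0 + a1 + 2 * a2 + a3 + a4 = 1.
Implicit Types eta t X Y : K.

Let a1E : a1 = 1 - a0 - 2 * a2 - a3 - a4.
Proof. by rewrite -[X in X - a0]sum_a; ring. Qed.

(** The primitive in Y of D4_Q along x = X - t: the coefficient of [Y ^+ 2] is
    half the one of Y in D4_Q, which is affine in z.  The last line is the
    constant of integration in Y: along x = X - t and at z = 0, D4_R is affine
    in X with slope [2 * a2 ^+ 2 * (1 - 2 * t - eta)], and this line is its
    primitive in X, written so as to involve no division by 2. *)
Definition D4_ham_num eta (X Y t : K^o) : K^o :=
  X * (X - 1) * (X - t) * (X - t - eta) * (1 - 2 * t - eta) * Y ^+ 2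
  + D4_Q a0 a1 a2 a3 a4 eta (X - t) X 0 * Y
  + (D4_R a0 a1 a2 a3 a4 eta (- t) 0 0 + a2 ^+ 2 * (1 - 2 * t - eta) * X) * X.

Lemma D4_ham_num_derivY eta (X Y t : K^o) :
  is_derive Y 1 (fun Y' => D4_ham_num eta X Y' t)
    (D4_Q a0 a1 a2 a3 a4 eta (X - t) X Y : K^o).
Proof.
rewrite /D4_ham_num; apply: is_derive_eq.
rewrite /GRing.scale /= /D4_Q; ring.
Qed.

(** The integrability condition of the Hamiltonian system; the identity of
    polynomials behind it holds on the hyperplane of normalized parameters,
    whence the elimination of a1. *)
Lemma D4_ham_num_derivX eta (X Y t : K^o) :
  is_derive X 1 (fun X' => D4_ham_num eta X' Y t)
    (D4_R a0 a1 a2 a3 a4 eta (X - t) X Y : K^o).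
Proof.
rewrite /D4_ham_num /D4_Q; apply: is_derive_eq.
rewrite /GRing.scale /= a1E /D4_R; ring.
Qed.

Definition D4_ham eta (X Y t : K^o) : K^o :=
  D4_ham_num eta X Y t / (VI_den eta).[t].

Lemma D4_ham_derivY eta (X Y t : K^o) :
  is_derive Y 1 (fun Y' => D4_ham eta X Y' t)
    (D4_Q a0 a1 a2 a3 a4 eta (X - t) X Y / (VI_den eta).[t] : K^o).
Proof.
have dY := D4_ham_num_derivY eta X Y t.
by rewrite /D4_ham; apply: is_derive_eq; rewrite scaler0 add0r mulrC.
Qed.

Lemma D4_ham_derivX eta (X Y t : K^o) :
  is_derive X 1 (fun X' => D4_ham eta X' Y t)
    (D4_R a0 a1 a2 a3 a4 eta (X - t) X Y / (VI_den eta).[t] : K^o).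
Proof.
have dX := D4_ham_num_derivX eta X Y t.
by rewrite /D4_ham; apply: is_derive_eq; rewrite scaler0 add0r mulrC.
Qed.

Lemma partialY_D4_ham eta (X Y t : K^o) : partialY (D4_ham eta) X Y t
  = D4_Q a0 a1 a2 a3 a4 eta (X - t) X Y / (VI_den eta).[t].
Proof.
by rewrite /partialY derive1E;
  have /@derive_val := D4_ham_derivY eta X Y t.
Qed.

Lemma partialX_D4_ham eta (X Y t : K^o) : partialX (D4_ham eta) X Y t
  = D4_R a0 a1 a2 a3 a4 eta (X - t) X Y / (VI_den eta).[t].
Proof.
by rewrite /partialX derive1E;
  have /@derive_val := D4_ham_derivX eta X Y t.
Qed.

(** The first two equations of the system add up to an equation for x - y;
    this identity says that x - y = - t solves it. *)
Lemma D4_PQ_sum eta t X Y :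
  D4_P a0 a1 a2 a3 a4 eta (X - t) X Y + D4_Q a0 a1 a2 a3 a4 eta (X - t) X Y
  = (VI_den eta).[t].
Proof. rewrite horner_VI_den a1E /D4_P /D4_Q; ring. Qed.

(** The relations between the unknowns are required near t, and not only at t,
    so that they can be differentiated there. *)
Lemma D4_system_hamiltonian eta (x y z X Y : K^o -> K^o) (t : K^o) :
  eta != 0 -> (VI_den eta).[t] != 0 ->
  (\near t, [/\ x t = y t - t, X t = y t & Y t = z t]) ->
  D4_system eta (VI_b eta) a0 a1 a2 a3 a4 x y z t
  <-> hamiltonian_system (D4_ham eta) X Y t.
Proof.
move=> eta0 dent xyz.
have [xt Xt Yt] := nbhs_singleton xyz.
have nx : {near t, (y - id) =1 x} by near=> s; have [] := near xyz s.
have nX : {near t, X =1 y} by near=> s; have [] := near xyz s.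
have nY : {near t, Y =1 z} by near=> s; have [] := near xyz s.
have nX' : {near t, y =1 X} by near=> s; have [] := near xyz s.
have nY' : {near t, z =1 Y} by near=> s; have [] := near xyz s.
rewrite /hamiltonian_system partialX_D4_ham partialY_D4_ham Xt Yt.
rewrite !derive1E (near_eq_derive _ nX) (near_eq_derive _ nY).
have dxE : derivable y t 1 -> derive1 x t = derive1 y t - 1.
  by move=> dy; rewrite !derive1E -(near_eq_derive _ nx) deriveB// derive_id.
have PQ := D4_PQ_sum eta t (y t) (z t).
rewrite /D4_system two_eta_over_VI_b// opprK xt !derive1E; split.
  move=> [[_ dy dz] [_ Qy Rz]]; split.
  - exact: near_eq_derivable dy.
  - exact: near_eq_derivable dz.
  - by rewrite -Qy mulrC mulKf.
  - by rewrite -Rz mulNr mulNr opprK mulrC mulKf.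
move=> [dX dY eX eY].
have dy : derivable y t 1 by exact: near_eq_derivable dX.
have dz : derivable z t 1 by exact: near_eq_derivable dY.
have dx : derivable x t 1.
  exact: near_eq_derivable nx (derivableB dy (@derivable_id _ _ _ _)).
split; split => //.
- rewrite -derive1E dxE// derive1E eX mulrBr mulr1 mulNr opprK mulrC divfK//.
  by rewrite -PQ; ring.
- by rewrite eX mulrC divfK.
- by rewrite eY mulrNN mulrC divfK.
Unshelve. all: by end_near. Qed.

Lemma H_VI_derivY (X Y t : K^o) :
  is_derive Y 1 (fun Y' : K^o => H_VI a1 a0 a2 a3 a4 X Y' t : K^o)
   ((2 * Y * (X - t) * (X - 1) * X - ((a1 - 1) * (X - 1) * X
     + a3 * (X - t) * X + a4 * (X - t) * (X - 1))) / (t * (t - 1)) : K^o).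
Proof.
rewrite /H_VI; apply: is_derive_eq; rewrite /GRing.scale /=; ring.
Qed.

Lemma H_VI_derivX (X Y t : K^o) :
  is_derive X 1 (fun X' : K^o => H_VI a1 a0 a2 a3 a4 X' Y t : K^o)
   ((Y ^+ 2 * (3 * X ^+ 2 - 2 * (1 + t) * X + t)
     - ((a1 - 1) * (2 * X - 1) + a3 * (2 * X - t) + a4 * (2 * X - t - 1)) * Y
     + a2 * (a0 + a2)) / (t * (t - 1)) : K^o).
Proof.
rewrite /H_VI; apply: is_derive_eq; rewrite /GRing.scale /=; ring.
Qed.

Lemma cvg_partialY_D4_ham (X Y t : K^o) : t != 0 -> t != 1 ->
  partialY (D4_ham eta) X Y t @[eta --> cinfty_nbhs K]
    --> partialY (H_VI a1 a0 a2 a3 a4) X Y t.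
Proof.
move=> t0 t1.
rewrite [X in _ --> X]/partialY derive1E.
have /@derive_val -> := H_VI_derivY X Y t.
set q2 := (X in X / _).
(* D4_Q is c2 eta^2 + c1 eta + c0 with c2 = q2, so that c0 and c1 can be read
   off from its values at eta = 0 and eta = 1 *)
pose Q eta := D4_Q a0 a1 a2 a3 a4 eta (X - t) X Y.
have := cvg_quadratic_over_VI_den t q2 (Q 1 - q2 - Q 0) (Q 0) t0 t1.
apply: cvg_trans; apply: near_eq_cvg; near=> eta.
rewrite partialY_D4_ham; congr (_ / _); rewrite /Q /q2 a1E /D4_Q; ring.
Unshelve. all: by end_near. Qed.

Lemma cvg_partialX_D4_ham (X Y t : K^o) : t != 0 -> t != 1 ->
  partialX (D4_ham eta) X Y t @[eta --> cinfty_nbhs K]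
    --> partialX (H_VI a1 a0 a2 a3 a4) X Y t.
Proof.
move=> t0 t1.
rewrite [X in _ --> X]/partialX derive1E.
have /@derive_val -> := H_VI_derivX X Y t.
set q2 := (X in X / _).
pose r eta := D4_R a0 a1 a2 a3 a4 eta (X - t) X Y.
have := cvg_quadratic_over_VI_den t q2 (r 1 - q2 - r 0) (r 0) t0 t1.
apply: cvg_trans; apply: near_eq_cvg; near=> eta.
rewrite partialX_D4_ham; congr (_ / _); rewrite /r /q2 a1E /D4_R; ring.
Unshelve. all: by end_near. Qed.

End D4Hamiltonian.

Theorem theorem3p2 (R : realType) (a0 a1 a2 a3 a4 A0 A1 A2 A3 A4 : R[i]) :
  a0 + a1 + 2 * a2 + a3 + a4 = 1 ->
  a0 = A1 -> a1 = A0 -> a2 = A2 -> a3 = A3 -> a4 = A4 ->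
  exists H : R[i] -> (R[i])^o -> (R[i])^o -> (R[i])^o -> (R[i])^o,
    [/\ forall (eta t : R[i]), eta != 0 -> (VI_den eta).[t] != 0 ->
          forall X Y : (R[i])^o, has_partials (H eta) X Y t,
        forall (eta : R[i]) (U : set (R[i])^o),
          eta != 0 -> open U -> (forall t, U t -> (VI_den eta).[t] != 0) ->
          forall x y z X Y : (R[i])^o -> (R[i])^o,
          (forall t, U t -> [/\ x t = y t - t, X t = y t & Y t = z t]) ->
          (forall t, U t ->
             D4_system eta (VI_b eta) a0 a1 a2 a3 a4 x y z t) <->
          (forall t, U t -> hamiltonian_system (H eta) X Y t)
      & forall X Y t : (R[i])^o, t != 0 -> t != 1 ->
          partialY (H eta) X Y t @[eta --> cinfty_nbhs R[i]]
            --> partialY (H_VI A0 A1 A2 A3 A4) X Y t /\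
          - partialX (H eta) X Y t @[eta --> cinfty_nbhs R[i]]
            --> - partialX (H_VI A0 A1 A2 A3 A4) X Y t].

Proof.
move=> sum_a <- <- <- <- <-; exists (D4_ham a0 a1 a2 a3 a4); split.
- move=> eta t _ _ X Y; split.
    by have [] := D4_ham_derivX _ _ _ _ _ sum_a eta X Y t.
  by have [] := D4_ham_derivY a0 a1 a2 a3 a4 eta X Y t.
- move=> eta U eta0 Uopen Uden x y z X Y xyz.
  have local t : U t -> D4_system eta (VI_b eta) a0 a1 a2 a3 a4 x y z t
      <-> hamiltonian_system (D4_ham a0 a1 a2 a3 a4 eta) X Y t.
    move=> Ut; apply: D4_system_hamiltonian => //; first exact: Uden.
    by apply: filterS xyz _; exact: open_nbhs_nbhs.
  by split=> sys t Ut; apply/(local t Ut); exact: sys.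
- move=> X Y t t0 t1; split; first exact: cvg_partialY_D4_ham.
  by apply: cvgN; exact: cvg_partialX_D4_ham.
Qed.
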